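(* Let $U,W,N\ge 1$ be integers. Consider a decoder with $U$ upper layers whose attention is causal and document-isolated, with inclusive local window $W$ and with a fixed complete global key/value bank, and whose normalization, residual and feedforward operations are positionwise (as specified in the context), run on a prompt of length $N$ with fixed lower-stack outputs $H^0_1,\dots,H^0_N$. For $j\in\{1,\dots,U\}$ put $$r_{\rm in}(j)=\min\{N,\,1+(U-j+1)(W-1)\},\qquad r_{\rm out}(j)=\min\{N,\,1+(U-j)(W-1)\}.$$ Consider the suffix execution which, successively for $j=1,\dots,U$, projects the local keys and values of layer $j$ only from the inputs at the last $r_{\rm in}(j)$ positions, saves the last $\min(N,W)$ of these local key/value entries, and computes the queries, attention outputs, residuals and feedforward outputs of layer $j$ only at the last $r_{\rm out}(j)$ positions, using the original positions and masks. Then, in exact (real) arithmetic, the suffix execution returns the same prompt-end output and the same complete saved cache as full upper prefill. That is, $\widetilde H^U_N=H^U_N$ (hence the prompt-end logits agree), and for every $j\in\{1,\dots,U\}$ and every position $i$ with $N-\min(N,W)<i\le N$ the saved local entries satisfy $(\widetilde k^j_i,\widetilde v^j_i)=(k^j_i,v^j_i)$, while the lower-layer key/value entries, the global key/value bank and the document metadata are identical in the two executions. Here quantities without tilde are those of full upper prefill and quantities with tilde are those of the suffix execution.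
   Context: Positions and masks. Prompt positions are $1,\dots,N$. Each position $t$ carries a document identifier $\mathrm{doc}(t)$ and a rotary position $p_t$ (its position within its document); these are fixed data. For each $t$ let $$G_t=\{i: 1\le i\le t,\ \mathrm{doc}(i)=\mathrm{doc}(t)\},\qquad L_t(W)=\{i: 1\le i\le N,\ t-W<i\le t,\ \mathrm{doc}(i)=\mathrm{doc}(t)\}.$$ Both contain $t$. Lower stack and global bank. A lower causal stack has been run on the whole prompt. Its hidden outputs $H^0_1,\dots,H^0_N$ (real vectors), its own key/value entries, and a global bank $(k^g_i,v^g_i)_{1\le i\le N}$ computed from $H^0_1,\dots,H^0_N$ and shared by all upper layers, are complete, fixed, and common to both executions below. Upper layers (full upper prefill). For each layer $j=1,\dots,U$ there are fixed positionwise maps: $Q_j,K_j,V_j$ (normalization of the layer input, projection, and, for queries and keys, the rotary transform at the given rotary position) and $\Phi_j$ (output projection, residual additions, normalization and feedforward block, all acting on a single position). For all $t\in\{1,\dots,N\}$ set $$q^j_t=Q_j(H^{j-1}_t,p_t),\quad k^j_t=K_j(H^{j-1}_t,p_t),\quad v^j_t=V_j(H^{j-1}_t),$$ $$a^j_t=\frac{\sum_{i\in G_t}e^{s^g_{ti}}v^g_i+\sum_{i\in L_t(W)}e^{s^j_{ti}}v^j_i}{\sum_{i\in G_t}e^{s^g_{ti}}+\sum_{i\in L_t(W)}e^{s^j_{ti}}},\qquad s^g_{ti}=\frac{q^j_t\cdot k^g_i}{\sqrt{d}},\quad s^j_{ti}=\frac{q^j_t\cdot k^j_i}{\sqrt{d}},$$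 $$H^j_t=\Phi_j(H^{j-1}_t,a^j_t),$$ where $d$ is the head dimension. With several heads, the formula for $a^j_t$ is applied separately for each query head (each query head using a fixed assigned key/value head) and $a^j_t$ is the concatenation of the results. A global entry and a local entry at the same source position are distinct entries of the same softmax. Prompt-end output and complete saved cache. The prompt-end output is $H^U_N$, from which the prompt-end logits are obtained by a fixed positionwise output head. The complete saved cache consists of: all key/value entries of the lower layers at all $N$ positions; the global bank at all $N$ positions; for each upper layer $j$, the local entries $(k^j_i,v^j_i)$ at the last $\min(N,W)$ positions; and the document metadata. Suffix execution. ''The last $r$ positions'' means $\{N-r+1,\dots,N\}$. Set $\widetilde H^0_t=H^0_t$ for $t$ in the last $r_{\rm in}(1)$ positions. For $j=1,\dots,U$ in turn: the inputs $\widetilde H^{j-1}_t$ are available for $t$ in the last $r_{\rm in}(j)$ positions (note $r_{\rm in}(j)=r_{\rm out}(j-1)$ for $j\ge 2$); compute $\widetilde k^j_t=K_j(\widetilde H^{j-1}_t,p_t)$ and $\widetilde v^j_t=V_j(\widetilde H^{j-1}_t)$ for those $t$ and save those with $t$ in the last $\min(N,W)$ positions; then, for $t$ in the last $r_{\rm out}(j)$ positions only, compute $\widetilde q^j_t=Q_j(\widetilde H^{j-1}_t,p_t)$, compute $\widetilde a^j_t$ by the same joint-softmax formula with the tilde quantities, the same global bank, global index set $G_t$, and local index set consisting of those $i\in L_t(W)$ that lie in the last $r_{\rm in}(j)$ positions, and set $\widetilde H^j_t=\Phi_j(\widetilde H^{j-1}_t,\widetilde a^j_t)$. The original rotary positions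 $p_t$ and document identifiers are used throughout. *)

(* Defs.v *)
From HB Require Import structures.
From mathcomp Require Import all_boot all_order all_algebra.
From mathcomp Require Import reals sequences exp.
Set Implicit Arguments.
Unset Strict Implicit.
Unset Printing Implicit Defensive.
Import Order.TTheory GRing.Theory Num.Theory.
Local Open Scope ring_scope.

(* Conventions.  The prompt position t in {1,...,N} is the ordinal of value    *)
(* t - 1 in 'I_N; upper layers keep their numbers 1,...,U.  A multi-head query *)
(* (key, value) is a matrix whose h-th row belongs to head h.                  *)

(* The maps of one upper layer: m is the hidden dimension, d the dimension of  *)
(* queries and keys, dv that of values, and nq, nl, ng are the numbers of      *)
(* query heads, of local key/value heads and of heads of the global bank.      *)
(* lkv_head and gkv_head assign to a query head the local and the global       *)
(* key/value head that it reads.                                               *)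
Record upper_layer (R : realType) (m d dv nq nl ng : nat) := UpperLayer {
  proj_q : 'rV[R]_m -> nat -> 'M[R]_(nq, d);
  proj_k : 'rV[R]_m -> nat -> 'M[R]_(nl, d);
  proj_v : 'rV[R]_m -> 'M[R]_(nl, dv);
  post_attn : 'rV[R]_m -> 'rV[R]_(nq * dv) -> 'rV[R]_m;
  lkv_head : 'I_nq -> 'I_nl;
  gkv_head : 'I_nq -> 'I_ng }.

(* The data shared by both executions: document identifiers, rotary positions, *)
(* and the results of the lower stack, which has nlow layers with key/value    *)
(* entries of an arbitrary type E.                                             *)
Record prompt (R : realType) (N m d dv ng nlow : nat) (D : eqType) (E : Type) :=
  Prompt {
  doc : 'I_N -> D;
  rotary : 'I_N -> nat;
  lower_out : 'I_N -> 'rV[R]_m;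
  lower_kv : 'I_nlow -> 'I_N -> E;
  bank_k : 'I_N -> 'M[R]_(ng, d);
  bank_v : 'I_N -> 'M[R]_(ng, dv) }.

(* A local entry is None at a position whose entry is not saved; the local     *)
(* entries of layer j.+1 are indexed by j : 'I_U.                              *)
Record saved_cache (R : realType) (N U d dv nl ng nlow : nat) (D : eqType)
    (E : Type) := SavedCache {
  cache_lower : {ffun 'I_nlow * 'I_N -> E};
  cache_bank : {ffun 'I_N -> 'M[R]_(ng, d) * 'M[R]_(ng, dv)};
  cache_local :
    {ffun 'I_U * 'I_N -> option ('M[R]_(nl, d) * 'M[R]_(nl, dv))};
  cache_docs : {ffun 'I_N -> D * nat} }.

Definition last_positions (N r : nat) : {set 'I_N} :=
  [set t : 'I_N | (N - r <= t)%N].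

(* The positions among the last r, as a type: a function on tail N r has       *)
(* values at these positions only.                                             *)
Definition tail (N r : nat) : finType := {t : 'I_N | t \in last_positions N r}.

Lemma tail_weaken_subproof N r r' (le : (r' <= r)%N) (t : tail N r') :
  val t \in last_positions N r.
Proof.
by have := valP t; rewrite !inE; apply: leq_trans; rewrite leq_sub2l.
Qed.

Definition tail_weaken N r r' (le : (r' <= r)%N) (t : tail N r') : tail N r :=
  exist _ (val t) (tail_weaken_subproof le t).

(* For 1 <= j <= U, U.+1 - j is U - j + 1; in this form r_in j.+1 and r_out j  *)
(* are convertible for every j, and suffix_hidden below needs no cast.         *)
Definition r_in (N U W j : nat) : nat := minn N (1 + (U.+1 - j) * (W - 1)).
Definition r_out (N U W j : nat) : nat := minn N (1 + (U - j) * (W - 1)).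

Lemma r_out_le_in N U W j : (r_out N U W j <= r_in N U W j)%N.
Proof.
rewrite /r_out /r_in leq_min geq_minl /= (leq_trans (geq_minr _ _)) //.
by rewrite leq_add2l leq_mul2r leq_sub2r ?orbT.
Qed.

Lemma last_pos_subproof N (hN : (0 < N)%N) : (N.-1 < N)%N.
Proof. by rewrite ltn_predL. Qed.

Definition last_pos N (hN : (0 < N)%N) : 'I_N := Ordinal (last_pos_subproof hN).

Lemma last_tail_subproof N U W j (hN : (0 < N)%N) :
  last_pos hN \in last_positions N (r_out N U W j).
Proof.
by rewrite inE /= -subn1 leq_sub2l // leq_min hN.
Qed.

Definition last_tail N U W j (hN : (0 < N)%N) : tail N (r_out N U W j) :=
  exist _ (last_pos hN) (last_tail_subproof U W j hN).

Section Execution.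
Variables (R : realType) (N U W m d dv nq nl ng nlow : nat).
Variables (D : eqType) (E : Type).
(* Only the layers 1,...,U are run. *)
Variable layer : nat -> upper_layer R m d dv nq nl ng.
Variable P : prompt R N m d dv ng nlow D E.

Definition global_set (t : 'I_N) : {set 'I_N} :=
  [set i : 'I_N | (i <= t)%N && (doc P i == doc P t)].

(* t - W < i is written t < i + W, since subtraction on nat is truncated. *)
Definition local_set (t : 'I_N) : {set 'I_N} :=
  [set i : 'I_N | [&& (t < i + W)%N, (i <= t)%N & doc P i == doc P t]].

Definition score n n' (q : 'M[R]_(n, d)) (h : 'I_n) (k : 'M[R]_(n', d))
    (h' : 'I_n') : R :=
  (\sum_(l < d) q h l * k h' l) / Num.sqrt d%:R.

(* The local keys and values are given on a finite type I of available         *)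
(* positions, of which A is the subset that is attended to.                    *)
Definition head_attention (L : upper_layer R m d dv nq nl ng) (t : 'I_N)
    (q : 'M[R]_(nq, d)) (I : finType) (A : {set I})
    (k : I -> 'M[R]_(nl, d)) (v : I -> 'M[R]_(nl, dv)) (h : 'I_nq) :
    'rV[R]_dv :=
  let g := gkv_head L h in
  let l := lkv_head L h in
  (\sum_(i in global_set t) expR (score q h (bank_k P i) g)
   + \sum_(i in A) expR (score q h (k i) l))^-1
  *: (\sum_(i in global_set t)
        expR (score q h (bank_k P i) g) *: row g (bank_v P i)
      + \sum_(i in A) expR (score q h (k i) l) *: row l (v i)).

(* mxvec concatenates the rows. *)
Definition attention (L : upper_layer R m d dv nq nl ng) (t : 'I_N)
    (q : 'M[R]_(nq, d)) (I : finType) (A : {set I})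
    (k : I -> 'M[R]_(nl, d)) (v : I -> 'M[R]_(nl, dv)) : 'rV[R]_(nq * dv) :=
  mxvec (\matrix_(h < nq) head_attention L t q A k v h).

Definition full_layer (L : upper_layer R m d dv nq nl ng)
    (X : 'I_N -> 'rV[R]_m) (t : 'I_N) : 'rV[R]_m :=
  let q := proj_q L (X t) (rotary P t) in
  let k i := proj_k L (X i) (rotary P i) in
  let v i := proj_v L (X i) in
  post_attn L (X t) (attention L t q (local_set t) k v).

Fixpoint full_hidden (j : nat) : 'I_N -> 'rV[R]_m :=
  if j is j'.+1 then full_layer (layer j) (full_hidden j') else lower_out P.

(* The local entries of layer j.+1. *)
Definition full_entry (j : nat) (i : 'I_N) :
    'M[R]_(nl, d) * 'M[R]_(nl, dv) :=
  (proj_k (layer j.+1) (full_hidden j i) (rotary P i),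
   proj_v (layer j.+1) (full_hidden j i)).

Definition suffix_layer (L : upper_layer R m d dv nq nl ng) (r r' : nat)
    (le : (r' <= r)%N) (X : tail N r -> 'rV[R]_m) (u : tail N r') : 'rV[R]_m :=
  let t := val u in
  let x := X (tail_weaken le u) in
  let q := proj_q L x (rotary P t) in
  let k (i : tail N r) := proj_k L (X i) (rotary P (val i)) in
  let v (i : tail N r) := proj_v L (X i) in
  post_attn L x
    (attention L t q [set i : tail N r | val i \in local_set t] k v).

Fixpoint suffix_hidden (j : nat) : tail N (r_out N U W j) -> 'rV[R]_m :=
  match j with
  | 0 => fun t => lower_out P (val t)
  | j'.+1 =>
      @suffix_layer (layer j'.+1) (r_in N U W j'.+1) (r_out N U W j'.+1)
        (r_out_le_in N U W j'.+1) (@suffix_hidden j')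
  end.

(* The local entries of layer j.+1, computed at the last r_in j.+1 positions.  *)
Definition suffix_entry (j : nat) (i : tail N (r_in N U W j.+1)) :
    'M[R]_(nl, d) * 'M[R]_(nl, dv) :=
  (proj_k (layer j.+1) (@suffix_hidden j i) (rotary P (val i)),
   proj_v (layer j.+1) (@suffix_hidden j i)).

(* insub i is None if i is not among the last r_in j.+1 positions.             *)
Definition suffix_saved (j : nat) (i : 'I_N) :
    option ('M[R]_(nl, d) * 'M[R]_(nl, dv)) :=
  if i \in last_positions N (minn N W)
  then omap (@suffix_entry j) (insub i) else None.

Definition full_saved (j : nat) (i : 'I_N) :
    option ('M[R]_(nl, d) * 'M[R]_(nl, dv)) :=
  if i \in last_positions N (minn N W) then Some (full_entry j i) else None.

Definition cache_with
    (saved : nat -> 'I_N -> option ('M[R]_(nl, d) * 'M[R]_(nl, dv))) :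
    saved_cache R N U d dv nl ng nlow D E :=
  SavedCache [ffun x : 'I_nlow * 'I_N => lower_kv P x.1 x.2]
    [ffun i => (bank_k P i, bank_v P i)]
    [ffun x : 'I_U * 'I_N => saved x.1 x.2]
    [ffun i => (doc P i, rotary P i)].

Definition full_cache := cache_with full_saved.
Definition suffix_cache := cache_with suffix_saved.

End Execution.

Arguments suffix_hidden {R N} U W {m d dv nq nl ng nlow D E} layer P j t.

(* Main.v *)
(* A query at one of the last [r] positions reads local entries only at the     *)
(* last [r + (W - 1)] positions, and [r_in j] exceeds [r_out j] by exactly      *)
(* [W - 1] before truncation at [N].  So by induction on the layers the suffix  *)
(* execution never misses an attended entry.  The saved entries are covered     *)
(* because [W <= 1 + (U - j + 1) (W - 1)] for [j <= U].                         *)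
Require Import Defs.
From mathcomp Require Import all_boot all_order all_algebra.
From mathcomp Require Import reals.
From mathcomp Require Import zify.
Local Open Scope ring_scope.

(** A layer's output at a position depends on the layer input only there and in its local window.
    [local_set_sub_r_in] keeps that window among the available inputs, so by [attention_tail] no
    softmax term is lost, and [suffix_hiddenE] follows by induction. [last_window_sub_r_in] does the
    same for the saved entries in [suffix_savedE]. *)

Lemma local_set_sub_r_in (R : realType) (N m d dv ng nlow : nat) (D : eqType)
    (E : Type) (P : prompt R N m d dv ng nlow D E) (U W j : nat) (t i : 'I_N) :
  (j < U)%N -> t \in last_positions N (r_out N U W j.+1) ->
  i \in local_set W P t -> i \in last_positions N (r_in N U W j.+1).
Proof.
move=> ltjU; rewrite !inE => le_t /and3P[lt_ti _ _]; move: le_t.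
(* Splitting off one summand [W - 1] leaves the same product in both radii; generalizing it makes
   the goal linear. *)
rewrite /r_out /r_in subSS -(subnSK ltjU) mulSn.
by move: ((U - j.+1) * (W - 1))%N => ?; lia.
Qed.

Lemma last_window_sub_r_in (N U W j : nat) (i : 'I_N) :
  (j < U)%N -> i \in last_positions N (minn N W) ->
  i \in last_positions N (r_in N U W j.+1).
Proof.
move=> ltjU; rewrite !inE; apply: leq_trans; apply: leq_sub2l.
rewrite /r_in subSS -(subnSK ltjU) mulSn.
by move: ((U - j.+1) * (W - 1))%N => ?; lia.
Qed.

(** Both local sums, in numerator and denominator, merely get reindexed along the subtype; the
    global sums are untouched. *)
Lemma attention_tail (R : realType) (N m d dv nq nl ng nlow : nat) (D : eqType)
    (E : Type) (P : prompt R N m d dv ng nlow D E)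
    (L : upper_layer R m d dv nq nl ng) (t : 'I_N) (q : 'M[R]_(nq, d)) (r : nat)
    (A : {set 'I_N}) (k : 'I_N -> 'M[R]_(nl, d)) (v : 'I_N -> 'M[R]_(nl, dv))
    (k' : tail N r -> 'M[R]_(nl, d)) (v' : tail N r -> 'M[R]_(nl, dv)) :
  A \subset last_positions N r ->
  (forall i, k' i = k (val i)) -> (forall i, v' i = v (val i)) ->
  attention P L t q [set i : tail N r | val i \in A] k' v'
    = attention P L t q A k v.
Proof.
move=> /subsetP sAr eqk eqv.
have sum_tail (V : nmodType) (F : 'I_N -> V) (F' : tail N r -> V) :
    (forall i, F' i = F (val i)) ->
    \sum_(i in [set i : tail N r | val i \in A]) F' i = \sum_(i in A) F i.
  move=> eqF; transitivity (\sum_(i in last_positions N r | i \in A) F i).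
    rewrite big_sub_cond; apply: eq_big => [i|i _]; last exact: eqF.
    by rewrite inE.
  by apply: eq_bigl => i; apply: andb_idl => /sAr.
congr mxvec; apply/row_matrixP => h; rewrite !rowK /head_attention.
congr (_^-1 *: _); congr (_ + _); apply: sum_tail => i; first by rewrite eqk.
by rewrite eqk eqv.
Qed.

Lemma suffix_hiddenE (R : realType) (N U W m d dv nq nl ng nlow : nat)
    (D : eqType) (E : Type) (layer : nat -> upper_layer R m d dv nq nl ng)
    (P : prompt R N m d dv ng nlow D E) (j : nat)
    (t : tail N (r_out N U W j)) :
  (j <= U)%N -> suffix_hidden U W layer P j t = full_hidden W layer P j (val t).
Proof.
elim: j t => [//|j IHj] t ltjU /=.
(* As [r_in j.+1] is convertible to [r_out j], this covers every input of the layer. *)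
have IH u : suffix_hidden U W layer P j u = full_hidden W layer P j (val u).
  exact: IHj (ltnW ltjU).
rewrite /suffix_layer /full_layer IH; congr post_attn.
apply: attention_tail => [|i|i]; try by rewrite IH.
by apply/subsetP => i; apply: local_set_sub_r_in => //; apply: valP.
Qed.

Lemma suffix_savedE (R : realType) (N U W m d dv nq nl ng nlow : nat)
    (D : eqType) (E : Type) (layer : nat -> upper_layer R m d dv nq nl ng)
    (P : prompt R N m d dv ng nlow D E) (j : nat) (i : 'I_N) :
  (j < U)%N ->
  suffix_saved U W layer P j i = full_saved W layer P j i.
Proof.
move=> ltjU; rewrite /suffix_saved /full_saved; case: ifP => // iW.
have ir := last_window_sub_r_in _ _ _ _ _ ltjU iW.
rewrite (insubT (fun t => t \in last_positions N (r_in N U W j.+1)) ir) /=.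
by rewrite /suffix_entry /full_entry suffix_hiddenE // ltnW.
Qed.

Theorem proposition1 (R : realType) (U W N : nat)
    (hU : (1 <= U)%N) (hW : (1 <= W)%N) (hN : (1 <= N)%N)
    (m d dv nq nl ng nlow : nat) (D : eqType) (E : Type)
    (layer : nat -> upper_layer R m d dv nq nl ng)
    (P : prompt R N m d dv ng nlow D E)
    (nvoc : nat) (output_head : 'rV[R]_m -> 'rV[R]_nvoc) :
  [/\ suffix_hidden U W layer P U (last_tail U W U hN)
        = full_hidden W layer P U (last_pos hN),
      output_head (suffix_hidden U W layer P U (last_tail U W U hN))
        = output_head (full_hidden W layer P U (last_pos hN)),
      (forall (j : 'I_U) (i : 'I_N), (N - minn N W < i.+1)%N ->
         cache_local (suffix_cache U W layer P) (j, i)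
           = Some (proj_k (layer j.+1) (full_hidden W layer P j i) (rotary P i),
                   proj_v (layer j.+1) (full_hidden W layer P j i)))
    & suffix_cache U W layer P = full_cache U W layer P].
Proof.
have eq_hidden : suffix_hidden U W layer P U (last_tail U W U hN)
    = full_hidden W layer P U (last_pos hN) by rewrite suffix_hiddenE.
have eq_cache : suffix_cache U W layer P = full_cache U W layer P.
  rewrite /suffix_cache /full_cache /cache_with; congr SavedCache.
  by apply/ffunP => -[j i]; rewrite !ffunE suffix_savedE.
split=> // [|j i ltNi]; first by rewrite eq_hidden.
(* The ordinal [i] stands for position [i.+1], hence the shift by [ltnS]. *)
by rewrite eq_cache ffunE /full_saved inE -ltnS ltNi.
Qed.
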